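(* Let $A'=[a'_{ijk}]$ be an $m'\times n'\times k'$ hypermatrix with entries in $\{0,1,-1\}$. Then there exist an integer $n\ge\max\{m',n',k'\}$, an $n\times n\times n$ ASHM $A=[a_{ijk}]$, and index sets $I=\{i_1<\cdots<i_{m'}\}$, $J=\{j_1<\cdots<j_{n'}\}$, $K=\{k_1<\cdots<k_{k'}\}\subseteq\{1,\ldots,n\}$ such that $a'_{pqr}=a_{i_pj_qk_r}$ for all $p,q,r$; that is, $A'$ is obtained from $A$ by deleting planes. Moreover, $A$ can be obtained from $A'$ by repeatedly inserting new planes (horizontal, row-vertical and column-vertical) each of which is a subpermutation matrix or the negative of a subpermutation matrix.
   Context: An $n\times n\times n$ hypermatrix $A=[a_{ijk}]$ is an alternating sign hypermatrix (ASHM) if all entries are in $\{0,\pm1\}$ and in every line (obtained by fixing two of the three indices) the nonzeros alternate in sign beginning and ending with $+1$. Planes of a hypermatrix are obtained by fixing one index: horizontal planes (fix the third index), row-vertical planes (fix the first index), column-vertical planes (fix the second index). A subpermutation matrix is a $(0,1)$-matrix with at most one $1$ in every row and column. *)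

(* Defs.v *)
From HB Require Import structures.
From mathcomp Require Import all_boot all_order all_algebra.
Set Implicit Arguments. Unset Strict Implicit. Unset Printing Implicit Defensive.
Import Order.TTheory GRing.Theory Num.Theory.
Local Open Scope ring_scope.

Definition hyp (m n k : nat) := 'I_m -> 'I_n -> 'I_k -> int.

(* A sequence of entries is an alternating line: its nonzero entries,
   read in order, are 1, -1, 1, ..., -1, 1 (nonempty, starting and ending with +1). *)
Definition alt_line (s : seq int) : bool :=
  let t := [seq x <- s | x != 0] in
  odd (size t) && (t == mkseq (fun i => (-1) ^+ i) (size t)).

Definition is_ASHM (n : nat) (A : hyp n n n) : Prop :=
  (forall i j k, A i j k \in [:: 0; 1; -1]) /\
  (forall j k, alt_line [seq A i j k | i <- enum 'I_n]) /\
  (forall i k, alt_line [seq A i j k | j <- enum 'I_n]) /\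
  (forall i j, alt_line [seq A i j k | k <- enum 'I_n]).

Definition subperm_mx (a b : nat) (P : 'I_a -> 'I_b -> int) : Prop :=
  (forall i j, P i j = 0 \/ P i j = 1) /\
  (forall i j1 j2, P i j1 = 1 -> P i j2 = 1 -> j1 = j2) /\
  (forall i1 i2 j, P i1 j = 1 -> P i2 j = 1 -> i1 = i2).

Definition pm_subperm_mx (a b : nat) (P : 'I_a -> 'I_b -> int) : Prop :=
  subperm_mx P \/ subperm_mx (fun i j => - P i j).

(* B is obtained from A by inserting a new horizontal plane (third index) at
   position t, which is a subpermutation matrix or its negative. *)
Definition ins_h m n k (A : hyp m n k) (B : hyp m n k.+1) : Prop :=
  exists t : 'I_k.+1,
    (forall i j (l : 'I_k), B i j (lift t l) = A i j l) /\
    pm_subperm_mx (fun i j => B i j t).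

(* Insertion of a row-vertical plane (first index fixed). *)
Definition ins_r m n k (A : hyp m n k) (B : hyp m.+1 n k) : Prop :=
  exists t : 'I_m.+1,
    (forall (i : 'I_m) j l, B (lift t i) j l = A i j l) /\
    pm_subperm_mx (fun j l => B t j l).

(* Insertion of a column-vertical plane (second index fixed). *)
Definition ins_c m n k (A : hyp m n k) (B : hyp m n.+1 k) : Prop :=
  exists t : 'I_n.+1,
    (forall i (j : 'I_n) l, B i (lift t j) l = A i j l) /\
    pm_subperm_mx (fun i l => B i t l).

Inductive reach m0 n0 k0 (A0 : hyp m0 n0 k0) : forall m n k, hyp m n k -> Prop :=
| reach_refl : reach A0 A0
| reach_h m n k (A : hyp m n k) (B : hyp m n k.+1) :
    reach A0 A -> ins_h A B -> reach A0 B
| reach_r m n k (A : hyp m n k) (B : hyp m.+1 n k) :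
    reach A0 A -> ins_r A B -> reach A0 B
| reach_c m n k (A : hyp m n k) (B : hyp m n.+1 k) :
    reach A0 A -> ins_c A B -> reach A0 B.

Definition strict_incr a b (f : 'I_a -> 'I_b) : Prop :=
  forall p q : 'I_a, (p < q)%N -> (f p < f q)%N.

(* Main.v *)
Require Import Defs.
From Stdlib Require Import FunctionalExtensionality.
From HB Require Import structures.
From mathcomp Require Import all_boot all_order all_algebra zify.
Import Order.TTheory GRing.Theory Num.Theory.
Set Implicit Arguments. Unset Strict Implicit. Unset Printing Implicit Defensive.

(** Insert planes with a single entry -1 until no line has two consecutive
    entries +1 (zeros ignored). Such a line becomes alternating, or zero, by
    inserting entries +1 only. Planes with a single +1 in the first direction
    make every line in that direction alternating or zero; then planes with a
    single +1 in the second and afterwards in the third direction make all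
    lines alternating in these directions, except inside the planes inserted
    last. In every row-vertical plane the number of zero lines left is the same,
    so they can be filled by column-vertical permutation planes given by a
    cyclic shift. Now every row-vertical plane is an ASM of some order N, and if
    there are m of them the zero lines in the first direction form an
    (N-m)-regular bipartite graph: by Hall's theorem it splits into N-m
    permutation matrices, which are the last planes to insert. *)

(** * Decomposition of regular bipartite graphs *)

Section Hall.
Variable T : finType.

Definition nbrs (N : T -> {set T}) (A : {set T}) : {set T} := \bigcup_(a in A) N a.

Lemma nbrsP (N : T -> {set T}) (A : {set T}) y : reflect (exists2 a, a \in A & y \in N a) (y \in nbrs N A).
Proof. exact: bigcupP. Qed.

(** Hall's theorem, by induction on the size of [X]: a nonempty proper subset with as many
    neighbours as elements splits the problem in two; without such a subset any edge at one vertex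
    can be chosen and its end removed. *)
Lemma hall_matching (N : T -> {set T}) (X : {set T}) :
  (forall A : {set T}, A \subset X -> #|A| <= #|nbrs N A|) ->
  exists g : T -> T, {in X, forall x, g x \in N x} /\ {in X &, injective g}.
Proof.
have [n] := ubnP #|X|; elim: n N X => // n IH N X; rewrite ltnS => leXn hall.
have [->|[x xX]] := set_0Vmem X.
  by exists id; split=> x; rewrite inE.
case: (boolP [exists A : {set T}, [&& A \proper X, A != set0 & #|nbrs N A| == #|A|]]).
  case/existsP=> A /and3P[pAX A0 /eqP cA]; have sAX := proper_sub pAX.
  have [g1 [g1N g1I]] : exists g : T -> T, {in A, forall x, g x \in N x} /\ {in A &, injective g}.
    apply: IH; first by apply: leq_trans leXn; apply: proper_card.
    by move=> B sBA; apply: hall; apply: subset_trans sAX.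
  have [g2 [g2N g2I]] : exists g : T -> T,
      {in X :\: A, forall x, g x \in N x :\: nbrs N A} /\ {in X :\: A &, injective g}.
    apply: (IH (fun x => N x :\: nbrs N A)).
      have := cardsID A X; rewrite (setIidPr sAX).
      by move: A0; rewrite -card_gt0; lia.
    move=> B; rewrite subsetD => /andP[sBX dBA].
    (* Hall's condition for [B] away from the neighbours of [A]: the union has enough neighbours,
       and [A] uses up exactly its own number. *)
    have := hall (A :|: B); rewrite subUset sAX sBX => /(_ isT).
    have -> : nbrs (fun y => N y :\: nbrs N A) B = nbrs N B :\: nbrs N A.
      apply/setP=> y; rewrite inE; apply/nbrsP/andP.
        by case=> b bB; rewrite inE => /andP[-> yb]; split=> //; apply/nbrsP; exists b.
      by case=> yA /nbrsP[b bB yb]; exists b => //; rewrite inE yA.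
    rewrite {1}/nbrs bigcup_setU -!/(nbrs _ _) cardsU.
    move: dBA; rewrite -setI_eq0 setIC => /eqP ->; rewrite cards0 subn0.
    rewrite cardsU; have := cardsID (nbrs N A) (nbrs N B).
    by rewrite setIC; have := subset_leq_card (subsetIl (nbrs N A) (nbrs N B)); lia.
  exists (fun y => if y \in A then g1 y else g2 y); split.
    move=> y yX; case: ifPn => yA; first exact: g1N.
    by have := g2N y; rewrite !inE yA yX => /(_ isT) /andP[].
  have g12 y z : y \in A -> z \in X :\: A -> g1 y <> g2 z.
    move=> yA /g2N; rewrite inE => /andP[/negP n2 _] e; apply: n2.
    by rewrite -e; apply/nbrsP; exists y => //; apply: g1N.
  move=> y z yX zX /=; case: ifPn => yA; case: ifPn => zA.
  - exact: g1I.
  - by move/g12; rewrite !inE zA zX => /(_ yA isT).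
  - by move/esym/g12; rewrite !inE yA yX => /(_ zA isT).
  - by apply: g2I; rewrite inE ?yA ?zA.
move/existsPn=> strict.
have := hall [set x]; rewrite sub1set xX cards1 => /(_ isT) /card_gt0P[s /nbrsP[x']].
rewrite inE => /eqP -> sx.
have [g [gN gI]] : exists g : T -> T,
    {in X :\ x, forall y, g y \in N y :\ s} /\ {in X :\ x &, injective g}.
  apply: (IH (fun y => N y :\ s)); first by move: leXn; rewrite (cardsD1 x X) xX.
  move=> B sBX.
  have -> : nbrs (fun y => N y :\ s) B = nbrs N B :\ s.
    apply/setP=> y; rewrite !inE; apply/nbrsP/andP.
      by case=> b bB; rewrite !inE => /andP[-> yb]; split=> //; apply/nbrsP; exists b.
    by case=> yA /nbrsP[b bB yb]; exists b => //; rewrite !inE yA.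
  have [->|B0] := eqVneq B set0; first by rewrite cards0.
  have pBX : B \proper X by apply: sub_proper_trans sBX (properD1 xX).
  have := strict B; rewrite pBX B0 /= => ne.
  (* The inequality is strict here, which pays for the deletion of [s]. *)
  have := hall B (proper_sub pBX); rewrite leq_eqVlt eq_sym (negbTE ne) /=.
  by rewrite (cardsD1 s (nbrs N B)); case: (s \in _) => /=; lia.
exists (fun y => if y == x then s else g y); split.
  move=> y yX; case: ifPn => [/eqP -> //|yx].
  by have := gN y; rewrite !inE yx yX => /(_ isT) /andP[].
have gs y : y \in X -> y != x -> g y <> s.
  by move=> yX yx; have := gN y; rewrite !inE yx yX => /(_ isT) /andP[/eqP].
move=> y z yX zX /=; case: (eqVneq y x) => [->|yx]; case: (eqVneq z x) => [->|zx] //.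
- by move/esym/(gs z zX zx).
- by move/(gs y yX yx).
- by apply: gI; rewrite !inE ?yx ?zx.
Qed.

Definition nbr (D : rel T) p : {set T} := [set q | D p q].
Definition conbr (D : rel T) q : {set T} := [set p | D p q].

(** Hall's condition by double counting: [d.+1 * #|A|] edges leave [A], and at most [d.+1] of them
    end at each neighbour. *)
Lemma regular_perfect_matching (D : rel T) d :
  (forall p, #|nbr D p| = d.+1) -> (forall q, #|conbr D q| = d.+1) ->
  exists g : T -> T, (forall p, D p (g p)) /\ injective g.
Proof.
move=> Dr Dc.
have [A _|g [gN gI]] := @hall_matching (nbr D) setT; last first.
  exists g; split=> [p|p q]; last exact: gI.
  by have := gN p; rewrite !inE => /(_ isT).
rewrite -(@leq_pmul2l d.+1) //.
have cardE (P : pred T) : #|[set x | P x]| = \sum_x P x.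
  by rewrite -sum1_card big_mkcond /=; apply: eq_bigr => x _; rewrite inE; case: (P x).
have -> : d.+1 * #|A| = \sum_(a in A) \sum_(q in nbrs (nbr D) A) D a q.
  rewrite mulnC -sum_nat_const; apply: eq_bigr => a aA.
  rewrite -(Dr a) cardE [RHS]big_mkcond; apply: eq_bigr => q _ /=.
  case: ifPn => // /nbrsP n; case: (boolP (D a q)) => // Daq; case: n.
  by exists a => //; rewrite inE.
rewrite exchange_big /= mulnC -sum_nat_const; apply: leq_sum => q _.
rewrite -(Dc q) cardE big_mkcond; apply: leq_sum => a _ /=; by case: ifP.
Qed.

(** Perfect matchings are split off one at a time, each lowering all degrees by one. *)
Lemma regular_decomposition (D : rel T) d :
  (forall p, #|nbr D p| = d) -> (forall q, #|conbr D q| = d) ->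
  exists f : nat -> T -> T,
    [/\ forall t, t < d -> injective (f t),
        forall t p, t < d -> D p (f t p),
        forall t t' p, t < d -> t' < d -> f t p = f t' p -> t = t' &
        forall p q, D p q -> exists2 t, t < d & f t p = q].
Proof.
elim: d D => [|d IH] D Dr Dc.
  exists (fun _ => id); split=> // p q Dpq.
  by have /setP/(_ q) := cards0_eq (Dr p); rewrite !inE Dpq.
have [g [gD gI]] := regular_perfect_matching Dr Dc.
have [p|q|f [fI fD fU fE]] := IH (fun p q => D p q && (q != g p)).
- have := Dr p; rewrite (cardsD1 (g p)) inE gD => -[<-].
  by apply: eq_card => q; rewrite !inE andbC.
(* An injective self-map of a finite type is onto, so the matching takes exactly one edge at [q]
   too. *)
- have /codomP[p0 qE] : q \in codom g by apply/inj_card_onto.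
  have := Dc q; rewrite (cardsD1 p0) inE qE gD => -[<-].
  by apply: eq_card => p; rewrite !inE andbC (inj_eq gI) eq_sym.
exists (fun t => if t == d then g else f t); split.
- by move=> t lt; case: (eqVneq t d) => // td; apply: fI; lia.
- move=> t p lt; case: (eqVneq t d) => // td.
  by have /andP[] : D p (f t p) && (f t p != g p) by apply: fD; lia.
- have fg t p : t < d -> f t p <> g p by move=> td; case/andP: (fD t p td) => _ /eqP.
  move=> t t' p lt lt'; case: (eqVneq t d) => [->|td]; case: (eqVneq t' d) => [->|td'] //.
  + by move/esym/fg => /(_ ltac:(lia)).
  + by move/fg => /(_ ltac:(lia)).
  + by apply: fU; lia.
- move=> p q Dpq; case: (eqVneq q (g p)) => [->|ne]; first by exists d; rewrite ?eqxx.
  have [|t lt E] := fE p q; first by rewrite Dpq ne.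
  by exists t; [lia | rewrite ifN //; lia].
Qed.

End Hall.

Local Open Scope ring_scope.

(** * Alternating sequences *)

Definition nz (s : seq int) : seq int := [seq x <- s | x != 0].

(** The flag [b] tells whether the last nonzero entry read is [1]. *)
Fixpoint no_pp (b : bool) (s : seq int) : bool :=
  if s is x :: s' then
    if x == 0 then no_pp b s'
    else if x == 1 then ~~ b && no_pp true s'
    else (x == -1) && no_pp false s'
  else true.

(* [b] is the sum of the entries already read. *)
Fixpoint alt (b : bool) (s : seq int) : bool :=
  if s is x :: s' then
    if x == 0 then alt b s'
    else if x == 1 then ~~ b && alt true s'
    else [&& x == -1, b & alt false s']
  else b.

Definition alt0 (s : seq int) : bool := (nz s == [::]) || alt false s.

Definition sgn_seq (s : seq int) : bool := all (fun x => x \in [:: 0; 1; -1]) s.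

Lemma no_pp_nz b s : no_pp b (nz s) = no_pp b s.
Proof.
elim: s b => [|x s IH] b //=; case: (eqVneq x 0) => [->|x0] /=; first exact: IH.
by rewrite (negbTE x0) !IH.
Qed.

Lemma alt_nz b s : alt b (nz s) = alt b s.
Proof.
elim: s b => [|x s IH] b //=; case: (eqVneq x 0) => [->|x0] /=; first exact: IH.
by rewrite (negbTE x0) !IH.
Qed.

Lemma nz_id s : nz (nz s) = nz s.
Proof. exact: filter_id. Qed.

Lemma alt0_nz s : alt0 (nz s) = alt0 s.
Proof. by rewrite /alt0 nz_id alt_nz. Qed.

Lemma sgn_seq_nz s : sgn_seq (nz s) = sgn_seq s.
Proof. by elim: s => //= x s IH; case: (eqVneq x 0) => [->|x0] /=; rewrite IH. Qed.

Lemma nz_cat s1 s2 : nz (s1 ++ s2) = nz s1 ++ nz s2.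
Proof. exact: filter_cat. Qed.

Lemma alt_entries b s : alt b s -> sgn_seq s.
Proof.
elim: s b => //= x s IH b; case: (eqVneq x 0) => [->|_] /=; first exact: IH.
case: (eqVneq x 1) => [->|_] /=; first by case/andP=> _ /IH.
by case/and3P=> /eqP -> _ /IH.
Qed.

(** The flag shifts the exponent: after an unmatched [1] the remaining nonzeros begin with -1 and
    are even in number. *)
Lemma alt_nzE b s : alt b s ->
  odd (size (nz s)) = ~~ b /\ nz s = mkseq (fun i => (-1) ^+ (i + b)) (size (nz s)).
Proof.
elim: s b => [|x s IH] b /=; first by move=> ->.
have iotaS (f g : nat -> int) n : (forall i, f i.+1 = g i) -> mkseq f n.+1 = f 0 :: mkseq g n.
  by move=> fg; rewrite /mkseq /= -[1%N]addn0 iotaDl -map_comp; congr cons; apply: eq_map.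
case: (eqVneq x 0) => [->|x0] /=; first exact: IH.
case: (eqVneq x 1) => [->|_] /=.
  case/andP=> nb /IH [-> E]; split; first by rewrite (negbTE nb).
  rewrite (@iotaS _ (fun i => (-1) ^+ (i + true))) ?(negbTE nb) //.
    by rewrite -E.
  by move=> i; rewrite addn0 addn1.
case/and3P=> /eqP -> -> /IH [-> E]; split=> //.
rewrite (@iotaS _ (fun i => (-1) ^+ (i + false))) //.
  by rewrite -E.
by move=> i; rewrite addn0 addn1 -[RHS]mul1r !exprS mulrA mulN1r opprK.
Qed.

Lemma alt_alt_line s : alt false s -> alt_line s.
Proof.
case/alt_nzE=> o E; rewrite /alt_line -/(nz s) o /= {1}E; apply/eqP.
by apply: eq_map => i; rewrite addn0.
Qed.

(** The entries still to come must bring the total to 1. With [b = false] this turns line conditions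
    into counts. *)
Lemma alt_sum b s : alt b s -> \sum_(x <- s) x = 1 - (b : nat)%:Z.
Proof.
elim: s b => [|x s IH] b /=; first by move=> ->; rewrite big_nil.
rewrite big_cons; case: (eqVneq x 0) => [->|x0] /=; first by rewrite add0r; apply: IH.
case: (eqVneq x 1) => [->|_] /=.
  by case/andP=> /negbTE -> /IH ->.
by case/and3P=> /eqP -> -> /IH ->.
Qed.

Lemma nz_sum s : \sum_(x <- nz s) x = \sum_(x <- s) x.
Proof.
elim: s => //= x s IH; rewrite big_cons -IH.
by case: (eqVneq x 0) => [->|x0] /=; rewrite ?add0r ?big_cons.
Qed.

Lemma nz1_alt s : nz s = [:: 1] -> alt false s.
Proof. by rewrite -alt_nz => ->. Qed.

(** * Repairing one sequence by inserting a single value *)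

Inductive fixable (v : int) (Q : pred (seq int)) : seq int -> Prop :=
| fixable_done s : Q s -> fixable v Q s
| fixable_ins s1 s2 : fixable v Q (s1 ++ v :: s2) -> fixable v Q (s1 ++ s2).

Lemma fixable_cons v Q x s :
  fixable v (fun t => Q (x :: t)) s -> fixable v Q (x :: s).
Proof.
elim=> [t Qt|s1 s2 _ IH]; first exact: fixable_done.
by rewrite -cat_cons; apply: fixable_ins.
Qed.

Lemma fixable_imp v (Q Q' : pred (seq int)) s :
  (forall t, Q t -> Q' t) -> fixable v Q s -> fixable v Q' s.
Proof.
move=> QQ'; elim=> [t Qt|s1 s2 _ IH]; first exact/fixable_done/QQ'.
exact: fixable_ins.
Qed.

(** A -1 is put in front of every [1] that follows another [1], zeros ignored. *)
Lemma fixable_no_pp s : sgn_seq s -> fixable (-1) (no_pp false) s.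
Proof.
suff H b : sgn_seq s -> fixable (-1) (no_pp b) s by apply: H.
elim: s b => [|x s IH] b /=; first by move=> _; apply: fixable_done.
case/andP; rewrite !inE; case/or3P=> /eqP -> sP.
- exact/fixable_cons/(fixable_imp _ (IH b sP)).
- case: b; last exact/fixable_cons/(fixable_imp _ (IH true sP)).
  apply: (@fixable_ins _ _ [::]); apply: fixable_cons => /=.
  exact/fixable_cons/(fixable_imp _ (IH true sP)).
- exact/fixable_cons/(fixable_imp _ (IH false sP)).
Qed.

(** A [1] is put in front of every -1 that does not follow a [1], and at the end unless the last
    nonzero is [1]; a zero sequence gets one [1]. *)
Lemma fixable_alt s : no_pp false s -> fixable 1 (alt false) s.
Proof.
suff H b : no_pp b s -> fixable 1 (alt b) s by apply: H.
elim: s b => [|x s IH] b /=.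
  case: b => _; first exact: fixable_done.
  by apply: (@fixable_ins _ _ [::] [::]); apply: fixable_done.
case: (eqVneq x 0) => [->|x0].
  by move=> /IH F; apply/fixable_cons/(fixable_imp _ F).
case: (eqVneq x 1) => [->|x1].
  by case: b => //= /IH F; apply/fixable_cons/(fixable_imp _ F).
case/andP=> /eqP -> /IH F; case: b; first exact/fixable_cons/(fixable_imp _ F).
apply: (@fixable_ins _ _ [::]).
exact/fixable_cons/fixable_cons/(fixable_imp _ F).
Qed.

(** The weaker goal is chosen for stability: planes inserted later may contain zero lines, which
    [alt false] excludes. *)
Lemma fixable_alt0 s : no_pp false s -> fixable 1 alt0 s.
Proof. by move/fixable_alt; apply: fixable_imp => t; rewrite /alt0 => ->; rewrite orbT. Qed.

Lemma nz_map0 (T : eqType) (f : T -> int) (s : seq T) :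
  {in s, forall x, f x = 0} -> nz (map f s) = [::].
Proof.
elim: s => //= x s IH f0; rewrite f0 ?mem_head //= IH // => y ys.
by rewrite f0 // in_cons ys orbT.
Qed.

Lemma nz_map1 (T : eqType) (f : T -> int) (s : seq T) v x0 :
  v != 0 -> uniq s -> x0 \in s -> f x0 = v -> {in s, forall x, x != x0 -> f x = 0} ->
  nz (map f s) = [:: v].
Proof.
move=> v0 us xs fx f0; case/splitPr: xs us f0 => s1 s2; rewrite cat_uniq /=.
case/and4P=> _; rewrite negb_or => /andP[x1 _] x2 _ f0.
rewrite map_cat nz_cat /= fx v0 !nz_map0 // => y ys; apply: f0.
- by rewrite mem_cat in_cons ys !orbT.
- by apply: contraNneq x2 => <-.
- by rewrite mem_cat ys.
- by apply: contraNneq x1 => <-.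
Qed.

Lemma nz_map_atmost1 (T : eqType) (f : T -> int) (s : seq T) v :
  v != 0 -> uniq s -> {in s, forall x, f x = 0 \/ f x = v} ->
  {in s &, forall x y, f x = v -> f y = v -> x = y} ->
  nz (map f s) = [::] \/ nz (map f s) = [:: v].
Proof.
move=> v0 us f01 fi; case: (boolP (has (fun x => f x == v) s)) => [/hasP[x xs /eqP fx]|/hasPn h].
  right; apply: (nz_map1 v0 us xs fx) => y ys yx; case: (f01 y ys) => // fy.
  by case/eqP: yx; apply: fi.
by left; apply: nz_map0 => x xs; case: (f01 x xs) => // /eqP fx; case/negP: (h x xs).
Qed.

(** * Fixing lines with single-entry planes *)

(* A hypermatrix is handled as a function of three labels together with the
   sequences R, C, H of labels of its row-vertical, column-vertical and
   horizontal planes, in order; inserting a plane inserts a fresh label. *)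
Definition lhyp := nat -> nat -> nat -> int.
Definition lpred := seq nat -> seq nat -> seq nat -> lhyp -> Prop.

(** For [v = 1] a subpermutation matrix, for [v = -1] the negative of one; values at labels outside
    [C] and [H] are left free. *)
Definition lsub (v : int) (C H : seq nat) (p : nat -> nat -> int) : Prop :=
  [/\ {in C & H, forall j z, p j z = 0 \/ p j z = v},
      {in C, forall j, {in H &, forall z z', p j z = v -> p j z' = v -> z = z'}} &
      {in H, forall z, {in C &, forall j j', p j z = v -> p j' z = v -> j = j'}}].

Definition set_plane (a : lhyp) (x : nat) (p : nat -> nat -> int) : lhyp :=
  fun i => if i == x then p else a i.

Definition ins_closed (G : lpred) : Prop := forall R1 R2 C H a x p v,
  v = 1 \/ v = -1 -> x \notin R1 ++ R2 -> lsub v C H p ->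
  G (R1 ++ R2) C H a -> G (R1 ++ x :: R2) C H (set_plane a x p).

(** Permuting the indices turns the second or third direction into the first, so that repairing
    lines is proved for one direction only. *)
Definition colG (G : lpred) : lpred := fun C R H c => G R C H (fun i j z => c j i z).
Definition horG (G : lpred) : lpred := fun H R C c => G R C H (fun i j z => c z i j).

Definition fresh (s : seq nat) : nat := (\max_(i <- s) i).+1.

Lemma fresh_notin s x : (fresh s <= x)%N -> x \notin s.
Proof.
move=> fx; apply/negP=> xs; have := @leq_bigmax_seq _ s predT id x xs isT.
by rewrite leqNgt fx.
Qed.

Lemma set_plane_line a x p j z R1 R2 : x \notin R1 ++ R2 ->
  [seq set_plane a x p i j z | i <- R1 ++ x :: R2] =
  [seq a i j z | i <- R1] ++ p j z :: [seq a i j z | i <- R2].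
Proof.
rewrite mem_cat negb_or => /andP[x1 x2]; rewrite map_cat /= /set_plane eqxx.
congr (_ ++ _ :: _); apply/eq_in_map => i iR; rewrite ifN //.
  by apply: contraNneq x1 => <-.
by apply: contraNneq x2 => <-.
Qed.

Definition single (v : int) (C H : seq nat) (p : nat -> nat -> int) : Prop :=
  exists j0 z0, [/\ j0 \in C, z0 \in H &
    forall j z, p j z = if (j == j0) && (z == z0) then v else 0].

Lemma single_lsub v C H p : v = 1 \/ v = -1 -> single v C H p -> lsub v C H p.
Proof.
move=> v1 [j0 [z0 [_ _ pE]]].
have pv j z : p j z = v -> j = j0 /\ z = z0.
  by rewrite pE; case: andP => [[/eqP -> /eqP ->]//|_]; case: v1 => ->.
split=> [j z _ _|j _ z z' _ _ /pv[_ ->] /pv[_ ->] //|z _ j j' _ _ /pv[-> _] /pv[-> _] //].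
by rewrite pE; case: ifP; [right|left].
Qed.

Definition extends (v : int) (C H R : seq nat) (a : lhyp) (R' : seq nat) (b : lhyp) : Prop :=
  [/\ {subset R <= R'}, {in R, forall i, b i = a i} &
      forall x, x \in R' -> x \notin R -> single v C H (b x)].

Lemma extends_refl v C H R a : extends v C H R a R a.
Proof. by split=> // x ->. Qed.

Lemma extends_trans v C H R a R' b R'' c :
  extends v C H R a R' b -> extends v C H R' b R'' c -> extends v C H R a R'' c.
Proof.
move=> [s1 e1 n1] [s2 e2 n2]; split=> [x /s1/s2 //|i iR|x xR'' xR].
  by rewrite e2 ?e1 // s1.
case: (boolP (x \in R')) => xR'; last exact: n2.
by rewrite e2 //; apply: n1.
Qed.

Section Phase.
Variables (G : lpred) (v : int).
Hypotheses (v1 : v = 1 \/ v = -1) (Gins : ins_closed G).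

(** Each inserted plane has its only nonzero entry on the line at [j0], [z0], so every other line in
    this direction gains zeros only. *)
Lemma fix_line (Q : pred (seq int)) R C H a j0 z0 : G R C H a -> j0 \in C -> z0 \in H ->
  fixable v Q [seq a i j0 z0 | i <- R] ->
  exists R' b, [/\ G R' C H b, extends v C H R a R' b, Q [seq b i j0 z0 | i <- R'] &
    forall j z, (j, z) != (j0, z0) ->
      nz [seq b i j z | i <- R'] = nz [seq a i j z | i <- R]].
Proof.
move=> + j0C z0H F; move E: (map _ _) F => s F.
elim: F R a E => {s} [s Qs R a E Ga|s1 s2 _ IH R a E Ga].
  by exists R, a; rewrite E; split=> //; apply: extends_refl.
set R1 := take (size s1) R; set R2 := drop (size s1) R.
have RE : R1 ++ R2 = R by apply: cat_take_drop.
have E1 : [seq a i j0 z0 | i <- R1] = s1 by rewrite map_take E take_size_cat.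
have E2 : [seq a i j0 z0 | i <- R2] = s2 by rewrite map_drop E drop_size_cat.
have xR : fresh R \notin R1 ++ R2 by rewrite RE fresh_notin.
set x := fresh R in xR.
pose p j z := if (j == j0) && (z == z0) then v else 0.
have ps : single v C H p by exists j0, z0.
have Gb : G (R1 ++ x :: R2) C H (set_plane a x p).
  by apply: (Gins v1 xR (single_lsub v1 ps)); rewrite RE.
have [|R' [b [GR' e Qb nb]]] := IH _ _ _ Gb.
  by rewrite set_plane_line // E1 E2 /p !eqxx.
exists R', b; split=> //; last first.
  move=> j z jz; rewrite nb // set_plane_line // /p.
  move: jz; rewrite xpair_eqE => /negbTE ->.
  by rewrite -[in RHS]RE map_cat !nz_cat.
apply: extends_trans e; split.
- by move=> i; rewrite -{1}RE !mem_cat in_cons => /orP[->|->] //; rewrite !orbT.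
- move=> i iR; rewrite /set_plane ifN //; apply: contraNneq xR => <-; by rewrite RE.
- move=> i; rewrite mem_cat in_cons orbCA -mem_cat RE => /orP[/eqP ->|->//] _.
  by rewrite /set_plane eqxx.
Qed.

(** As [Pre] and [Q] ignore zeros, repairing one line does not affect the status of the others, and
    the lines can be treated in turn. *)
Lemma fix_lines (Pre Q : pred (seq int)) R C H a :
  (forall s, Pre (nz s) = Pre s) -> (forall s, Q (nz s) = Q s) ->
  (forall s, Pre s -> fixable v Q s) -> G R C H a ->
  {in C & H, forall j z, Pre [seq a i j z | i <- R]} ->
  exists R' b, [/\ G R' C H b, extends v C H R a R' b &
    {in C & H, forall j z, Q [seq b i j z | i <- R']}].
Proof.
move=> Pnz Qnz PQ Ga PreA.
suff [R' [b [Gb e QP _]]] : exists R' b, [/\ G R' C H b, extends v C H R a R' b,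
    {in C & H, forall j z, (j, z) \in [seq (j, z) | j <- C, z <- H] ->
      Q [seq b i j z | i <- R']} &
    {in C & H, forall j z, (j, z) \notin [seq (j, z) | j <- C, z <- H] ->
      Pre [seq b i j z | i <- R']}].
  exists R', b; split=> // j z jC zH; apply: QP => //.
  by apply/allpairsP; exists (j, z).
(* In an arbitrary list a pair may be repeated or lie outside [C] and [H]; nothing is inserted for
   it then. *)
move: [seq (j, z) | j <- C, z <- H] => P; elim: P => [|[j0 z0] P [R1 [a1 [G1 e1 Q1 P1]]]].
  by exists R, a; split=> //; [apply: extends_refl|move=> j z jC zH _; apply: PreA].
case: (boolP [&& j0 \in C, z0 \in H & (j0, z0) \notin P]) => [/and3P[j0C z0H nP]|nn].
  have [R2 [b [G2 e2 Q2 n2]]] := fix_line G1 j0C z0H (PQ _ (P1 _ _ j0C z0H nP)).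
  exists R2, b; split=> //; first exact: extends_trans e2.
    move=> j z jC zH; rewrite in_cons; case: (eqVneq (j, z) (j0, z0)) => [[-> ->] //|ne] /=.
    by move=> jzP; rewrite -Qnz n2 // Qnz Q1.
  move=> j z jC zH; rewrite in_cons negb_or => /andP[ne jzP].
  by rewrite -Pnz n2 // Pnz P1.
exists R1, a1; split=> // j z jC zH.
  rewrite in_cons => /orP[/eqP[ej ez]|]; last exact: Q1.
  by apply: Q1 => //; move: nn; rewrite -ej -ez jC zH negbK.
by rewrite in_cons negb_or => /andP[_]; apply: P1.
Qed.

End Phase.

(** * Line conditions in the three directions and the insertion phases *)

Definition LI (Q : pred (seq int)) (R C H : seq nat) (a : lhyp) : Prop :=
  forall j z, j \in C -> z \in H -> Q [seq a i j z | i <- R].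
Definition LJ (Q : pred (seq int)) (R C H : seq nat) (a : lhyp) : Prop :=
  forall i z, i \in R -> z \in H -> Q [seq a i j z | j <- C].
Definition LZ (Q : pred (seq int)) (R C H : seq nat) (a : lhyp) : Prop :=
  forall i j, i \in R -> j \in C -> Q [seq a i j z | z <- H].

(* Line predicates that survive the insertion of planes with a single entry [v]. *)
Definition stable (v : int) (Q : pred (seq int)) : Prop :=
  [/\ forall s, Q (nz s) = Q s, Q [::] & Q [:: v]].

Lemma single_lineJ v C H p z : v != 0 -> uniq C -> single v C H p ->
  nz [seq p j z | j <- C] = [::] \/ nz [seq p j z | j <- C] = [:: v].
Proof.
move=> v0 uC [j0 [z0 [_ _ pE]]]; apply: nz_map_atmost1 => // [j _|j j' _ _].
  by rewrite pE; case: ifP; [right|left].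
rewrite !pE; case: eqP => [-> _|_ /= e]; last by rewrite -e eqxx in v0.
by case: eqP => [-> //|_ /= e]; rewrite -e eqxx in v0.
Qed.

Lemma single_swap v C H p : single v C H p -> single v H C (fun z j => p j z).
Proof. by case=> j0 [z0 [? ? pE]]; exists z0, j0; split=> // j z; rewrite andbC pE. Qed.

Lemma extends_swap v C H R a R' b : extends v C H R a R' b ->
  extends v H C R (fun i z j => a i j z) R' (fun i z j => b i j z).
Proof. by case=> s e n; split=> [//|i iR|x x1 x2]; [rewrite e | apply: single_swap; apply: n]. Qed.

(** Lines inside old planes are unchanged; inside a new plane a line is zero or has the single
    nonzero [v], and stability covers both. *)
Lemma extends_LJ v C H R a R' b Q : v != 0 -> uniq C -> stable v Q ->
  extends v C H R a R' b -> LJ Q R C H a -> LJ Q R' C H b.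
Proof.
move=> v0 uC [Qnz Q0 Q1] [_ e n] QR i z iR' zH.
case: (boolP (i \in R)) => iR; first by rewrite e //; apply: QR.
by rewrite -Qnz; case: (single_lineJ z v0 uC (n i iR' iR)) => ->.
Qed.

Lemma extends_LZ v C H R a R' b Q : v != 0 -> uniq H -> stable v Q ->
  extends v C H R a R' b -> LZ Q R C H a -> LZ Q R' C H b.
Proof.
move=> v0 uH Qs /extends_swap e QR i j iR' jC.
exact: (extends_LJ v0 uH Qs e QR iR' jC).
Qed.

(** All that the construction uses about [G], which will be reachability from the given
    hypermatrix. *)
Record reachable (G : lpred) : Prop := Reachable {
  reach_insI : ins_closed G;
  reach_insJ : ins_closed (colG G);
  reach_insZ : ins_closed (horG G);
  reach_uniq : forall R C H a, G R C H a -> [/\ uniq R, uniq C & uniq H] }.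

Section Stages.
Variable G : lpred.
Hypothesis Gr : reachable G.

Section Dir.
Variables (v : int) (Pre Q Q1 Q2 : pred (seq int)).
Hypotheses (v1 : v = 1 \/ v = -1) (Prenz : forall s, Pre (nz s) = Pre s)
  (Qnz : forall s, Q (nz s) = Q s) (PreQ : forall s, Pre s -> fixable v Q s)
  (Q1s : stable v Q1) (Q2s : stable v Q2).

Let v0 : v != 0. Proof. by case: v1 => ->. Qed.

Lemma fixI R C H a : G R C H a -> LI Pre R C H a -> LJ Q1 R C H a -> LZ Q2 R C H a ->
  exists R' b, [/\ G R' C H b, extends v C H R a R' b, LI Q R' C H b,
    LJ Q1 R' C H b & LZ Q2 R' C H b].
Proof.
move=> Ga Li Lj Lz; have [_ uC uH] := reach_uniq Gr Ga.
have [R' [b [Gb e Qb]]] := fix_lines v1 (reach_insI Gr) Prenz Qnz PreQ Ga Li.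
exists R', b; split=> //; first exact: extends_LJ e Lj.
exact: extends_LZ e Lz.
Qed.

Lemma fixJ R C H a : G R C H a -> LJ Pre R C H a -> LI Q1 R C H a -> LZ Q2 R C H a ->
  exists C' b, [/\ G R C' H b,
    extends v R H C (fun j i z => a i j z) C' (fun j i z => b i j z),
    LJ Q R C' H b, LI Q1 R C' H b & LZ Q2 R C' H b].
Proof.
move=> Ga Lj Li Lz; have [uR _ uH] := reach_uniq Gr Ga.
have [C' [b [Gb e Qb]]] := fix_lines (G := colG G) (R := C) (C := R) (a := fun j i z => a i j z)
  v1 (reach_insJ Gr) Prenz Qnz PreQ Ga Lj.
exists C', (fun i j z => b j i z); split=> //; first exact: extends_LJ e Li.
by move=> i j iR jC; apply: (extends_LZ v0 uH Q2s e) => // j' i' ? ?; apply: Lz.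
Qed.

Lemma fixZ R C H a : G R C H a -> LZ Pre R C H a -> LI Q1 R C H a -> LJ Q2 R C H a ->
  exists H' b, [/\ G R C H' b,
    extends v R C H (fun z i j => a i j z) H' (fun z i j => b i j z),
    LZ Q R C H' b, LI Q1 R C H' b & LJ Q2 R C H' b].
Proof.
move=> Ga Lz Li Lj; have [uR uC _] := reach_uniq Gr Ga.
have [H' [b [Gb e Qb]]] := fix_lines (G := horG G) (R := H) (C := R) (H := C)
  (a := fun z i j => a i j z) v1 (reach_insZ Gr) Prenz Qnz PreQ Ga Lz.
exists H', (fun i j z => b z i j); split=> //.
  by move=> j z jC zH; apply: (extends_LJ v0 uR Q1s e) => // z' j' ? ?; apply: Li.
by move=> i z iR zH; apply: (extends_LZ v0 uC Q2s e) => // z' i' ? ?; apply: Lj.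
Qed.

End Dir.

Lemma stable_sgn v : v = 1 \/ v = -1 -> stable v sgn_seq.
Proof. by move=> v1; split=> //; [exact: sgn_seq_nz | case: v1 => ->]. Qed.

Lemma stable_no_pp v : v = 1 \/ v = -1 -> stable v (no_pp false).
Proof. by move=> v1; split=> //; [exact: no_pp_nz | case: v1 => ->]. Qed.

Lemma stable_alt0 : stable 1 alt0.
Proof. by split=> //; exact: alt0_nz. Qed.

(** In each direction one phase inserts -1 and a later one inserts 1. Inside the planes of the last
    phase, second-direction lines are zero or have a single [1]; hence the restriction of [LJ] to
    the old [H]. *)
Lemma alt_all_but_new_horizontal R C H a :
  G R C H a -> R != [::] -> H != [::] ->
  (forall i j z, i \in R -> j \in C -> z \in H -> a i j z \in [:: 0; 1; -1]) ->
  exists R C H H' a, [/\ G R C H' a, R != [::], H != [::] & [/\ {subset H <= H'},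
    forall w, w \in H' -> w \notin H -> single 1 R C (fun i j => a i j w),
    LI alt0 R C H' a, LJ (alt false) R C H a & LZ (alt false) R C H' a]].
Proof.
have sub_nil (s s' : seq nat) : {subset s <= s'} -> s != [::] -> s' != [::].
  by case: s => // x s /(_ x (mem_head _ _)); case: s'.
move=> G0 R0 H0 ent.
have m1 : (-1 : int) = 1 \/ (-1 : int) = -1 by right.
have p1 : (1 : int) = 1 \/ (1 : int) = -1 by left.
have LI0 : LI sgn_seq R C H a by move=> j z jC zH; apply/allP => _ /mapP[i iR ->]; apply: ent.
have LJ0 : LJ sgn_seq R C H a by move=> j z jC zH; apply/allP => _ /mapP[i iR ->]; apply: ent.
have LZ0 : LZ sgn_seq R C H a by move=> j z jC zH; apply/allP => _ /mapP[i iR ->]; apply: ent.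
(* [no_pp false] is stable for both signs, so once reached in a direction it survives the phases for
   the other directions. *)
have [R1 [a1 [G1 [s1 _ _] Li1 Lj1 Lz1]]] := fixI m1 sgn_seq_nz (no_pp_nz false) fixable_no_pp
  (stable_sgn m1) (stable_sgn m1) G0 LI0 LJ0 LZ0.
have [C1 [a2 [G2 _ Lj2 Li2 Lz2]]] := fixJ m1 sgn_seq_nz (no_pp_nz false) fixable_no_pp
  (stable_no_pp m1) (stable_sgn m1) G1 Lj1 Li1 Lz1.
have [H1 [a3 [G3 [s3 _ _] Lz3 Li3 Lj3]]] := fixZ m1 sgn_seq_nz (no_pp_nz false) fixable_no_pp
  (stable_no_pp m1) (stable_no_pp m1) G2 Lz2 Li2 Lj2.
have [R4 [a4 [G4 [s4 _ _] Li4 Lj4 Lz4]]] := fixI p1 (no_pp_nz false) alt0_nz fixable_alt0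
  (stable_no_pp p1) (stable_no_pp p1) G3 Li3 Lj3 Lz3.
have [C5 [a5 [G5 _ Lj5 Li5 Lz5]]] := fixJ p1 (no_pp_nz false) (alt_nz false) fixable_alt
  stable_alt0 (stable_no_pp p1) G4 Lj4 Li4 Lz4.
have Lj5' : LJ alt0 R4 C5 H1 a5 by move=> i z iR zH; rewrite /alt0 Lj5 ?orbT.
have [H6 [a6 [G6 [s6 e6 n6] Lz6 Li6 Lj6]]] := fixZ p1 (no_pp_nz false) (alt_nz false) fixable_alt
  stable_alt0 stable_alt0 G5 Lz5 Li5 Lj5'.
exists R4, C5, H1, H6, a6; split=> //.
- exact: sub_nil s4 (sub_nil _ _ s1 R0).
- exact: sub_nil s3 H0.
split=> // i z iR zH; rewrite (_ : map _ _ = [seq a5 i j z | j <- C5]) ?Lj5 //.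
by apply: eq_map => j; have /(congr1 (fun f => f i j)) := e6 z zH.
Qed.

End Stages.

(** * Completion by permutation planes *)

(** The end is as good a position as any: in both uses, the lines across the new planes gain one [1]
    if they were zero and nothing otherwise. *)
Lemma append_planes (G : lpred) R C H a (X : seq nat) (p : lhyp) :
  ins_closed G -> uniq X -> {in X, forall x, x \notin R} ->
  {in X, forall x, lsub 1 C H (p x)} -> G R C H a ->
  exists b, [/\ G (R ++ X) C H b, {in R, forall i, b i = a i} & {in X, forall x, b x = p x}].
Proof.
move=> Gins; elim: X R a => [|x X IH] R a /= => [_ _ _ Ga|/andP[xX uX] XR pX Ga].
  by exists a; rewrite cats0.
have xR : x \notin R by apply: XR; rewrite mem_head.
have Gx : G (rcons R x) C H (set_plane a x (p x)).
  rewrite -cats1; apply: (Gins R [::] _ _ _ _ _ 1); rewrite ?cats0 //; first by left.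
  by apply: pX; rewrite mem_head.
have [||b [Gb bR bX]] := IH _ _ uX _ _ Gx.
- move=> y yX; rewrite mem_rcons in_cons negb_or XR ?andbT ?in_cons ?yX ?orbT //.
  by apply: contraNneq xX => <-.
- by move=> y yX; apply: pX; rewrite in_cons yX orbT.
exists b; split; first by rewrite -cat_rcons.
  move=> i iR; rewrite bR ?mem_rcons ?in_cons ?iR ?orbT // /set_plane ifN //.
  by apply: contraNneq xR => <-.
move=> y; rewrite in_cons => /orP[/eqP ->|]; last exact: bX.
by rewrite bR ?mem_rcons ?mem_head // /set_plane eqxx.
Qed.

Lemma alt_line_sum (T : Type) (f : T -> int) s : alt false (map f s) -> \sum_(x <- s) f x = 1.
Proof. by move/alt_sum; rewrite big_map subr0. Qed.

Lemma alt0_line_sum (T : Type) (f : T -> int) s :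
  alt0 (map f s) -> \sum_(x <- s) f x = (nz (map f s) != [::])%:R.
Proof.
case/orP=> [/eqP E|A]; first by rewrite -(big_map f xpredT id) -nz_sum E big_nil.
by rewrite alt_line_sum //; move: A; rewrite -alt_nz; case: (nz _).
Qed.

Lemma sum_pred (T : Type) (P : pred T) (s : seq T) :
  \sum_(x <- s) (P x)%:R = (count P s)%:Z.
Proof.
elim: s => [|x s IH]; first by rewrite big_nil.
by rewrite big_cons IH /=; case: (P x); rewrite ?add0r ?add0n ?PoszD.
Qed.

Lemma sum_one (T : Type) (s : seq T) : \sum_(x <- s) (1 : int) = (size s)%:Z.
Proof. by rewrite -(count_predT s) -sum_pred. Qed.

Lemma count_nth (P : pred nat) (s : seq nat) N : size s = N ->
  count P s = #|[set q : 'I_N | P (nth 0%N s q)]|.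
Proof.
by move=> <-; rewrite -sum1_count (big_nth 0%N) big_mkord -sum1dep_card.
Qed.

Section Completion.
Variable G : lpred.
Hypothesis Gr : reachable G.

(* Each new horizontal label w carries exactly one entry 1, in a single row plane
   i; [W i] collects them and has the same size c for every i. The inserted
   column planes are indexed by pairs (d, s) with 0 < d < m and s < c: in row
   plane i, plane (d, s) carries a 1 at the s-th label of W (i + d). *)
Lemma balance_planes R C H H' a : G R C H' a -> {subset H <= H'} ->
  (forall w, w \in H' -> w \notin H -> single 1 R C (fun i j => a i j w)) ->
  LI alt0 R C H' a -> LJ (alt false) R C H a -> LZ (alt false) R C H' a ->
  exists C' b, [/\ G R C' H' b, LI alt0 R C' H' b, LJ (alt false) R C' H' b &
    LZ (alt false) R C' H' b].
Proof.
move=> Ga sH new Li Lj Lz; have [uR uC uH] := reach_uniq Gr Ga.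
pose W i := [seq w <- H' | (w \notin H) && (nz [seq a i j w | j <- C] != [::])].
have WP i w : w \in W i = [&& w \in H', w \notin H & nz [seq a i j w | j <- C] != [::]].
  by rewrite mem_filter andbC.
have uW i : uniq (W i) by apply: filter_uniq.
have line_new i w : w \in H' -> w \notin H ->
    nz [seq a i j w | j <- C] = [::] \/ nz [seq a i j w | j <- C] = [:: 1].
  move=> w1 w2; have [i0 [j0 [_ _ E]]] := new w w1 w2.
  apply: nz_map_atmost1 => // [j _|j j' _ _]; first by rewrite E; case: ifP; [right|left].
  by rewrite !E; case: andP => // -[_ /eqP ->] _; case: andP => // -[_ /eqP ->].
have Wex w : w \in H' -> w \notin H -> exists2 i, i \in R & w \in W i.
  move=> w1 w2; have [i0 [j0 [iR jC E]]] := new w w1 w2; exists i0 => //.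
  rewrite WP w1 w2 /= (@nz_map1 _ _ _ 1 j0) ?E ?eqxx // => j _ /negbTE jj.
  by rewrite E jj andbF.
have Wfun i i' w : w \in W i -> w \in W i' -> i = i'.
  rewrite !WP => /and3P[w1 w2 n1] /and3P[_ _ n2]; have [i0 [j0 [iR jC E]]] := new w w1 w2.
  have aux k : nz [seq a k j w | j <- C] != [::] -> k = i0.
    move=> n; apply/eqP; apply: contraNT n => /negbTE k0.
    by rewrite nz_map0 // => j _; rewrite E k0.
  by rewrite (aux _ n1) (aux _ n2).
pose c := (size C - count (mem H) H')%N; pose m := size R.
have cW i : i \in R -> size (W i) = c.
  (* Row plane [i] is summed both ways: its third-direction lines give [size C], its
     second-direction lines give 1 for each old label and each label in [W i]. *)
  move=> iR; have : \sum_(z <- H') \sum_(j <- C) a i j z = (size C)%:Z.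
    rewrite exchange_big /= (eq_big_seq (fun _ => 1)); last first.
      by move=> j jC; apply: alt_line_sum; apply: Lz.
    by rewrite sum_one.
  rewrite (eq_big_seq (fun z => (z \in H)%:R +
    ((z \notin H) && (nz [seq a i j z | j <- C] != [::]))%:R)).
    rewrite big_split /= !sum_pred -PoszD => -[E].
    by rewrite /c -E /W size_filter addKn.
  move=> z zH' /=; case: (boolP (z \in H)) => zH /=.
    by rewrite addr0; apply: alt_line_sum; apply: Lj.
  by rewrite add0r alt0_line_sum // -alt0_nz; case: (line_new i z zH' zH) => ->.
(* The row plane [d] places after [i] in cyclic order. *)
pose nxt i d := nth 0%N R ((index i R + d) %% m).
have m0 i : i \in R -> (0 < m)%N by rewrite /m; case: (R).
have nxtR i d : i \in R -> nxt i d \in R.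
  by move=> iR; rewrite mem_nth // ltn_mod (m0 i).
have nxtI d d' i i' : i \in R -> i' \in R -> nxt i d = nxt i' d' ->
    (index i R + d = index i' R + d' %[mod m])%N.
  move=> iR iR' /eqP; have mp := m0 i iR.
  by rewrite nth_uniq ?ltn_mod // => /eqP.
(* The pair (d, s) has the label [fresh C + (d - 1) * c + s]. The shift 0 is left out because row
   plane [i] already has its entries on [W i]. *)
pose U := iota (fresh C) (m.-1 * c).
pose dd u := ((u - fresh C) %/ c).+1; pose ss u := ((u - fresh C) %% c)%N.
pose tgt u i := nth 0%N (W (nxt i (dd u))) (ss u).
have Ub u : u \in U -> (dd u < m)%N /\ (ss u < c)%N.
  rewrite mem_iota => /andP[u1 u2]; have e1 : (u - fresh C < m.-1 * c)%N by lia.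
  have c0 : (0 < c)%N by move: e1; case: (c) => //; rewrite muln0.
  by rewrite /dd /ss ltn_mod c0; split=> //; have := e1; rewrite -ltn_divLR //; lia.
have tgtW u i : u \in U -> i \in R -> tgt u i \in W (nxt i (dd u)).
  by move=> /Ub[_ s1] iR; rewrite mem_nth // cW ?nxtR.
have tgtH u i : u \in U -> i \in R -> (tgt u i \in H') && (tgt u i \notin H).
  by move=> uU iR; have := tgtW u i uU iR; rewrite WP => /and3P[-> ->].
(* The cyclic shift is injective and the sets [W] are disjoint, so no two entries of a column plane
   share a horizontal label. *)
have tgtI u i i' : u \in U -> i \in R -> i' \in R -> tgt u i = tgt u i' -> i = i'.
  move=> uU iR iR' E; have := tgtW u i' uU iR'; rewrite -E => /(Wfun _ _ _ (tgtW u i uU iR)).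
  move/nxtI => /(_ iR iR') /eqP; rewrite eqn_modDr !modn_small ?index_mem // => /eqP.
  by move/(congr1 (nth 0%N R)); rewrite !nth_index.
pose p u i w : int := (w == tgt u i)%:R.
have p1 u i w : p u i w = 1 -> w = tgt u i by rewrite /p; case: eqP.
have [||b [Gb bC bU]] := append_planes (p := p) (reach_insJ Gr) (iota_uniq _ _ : uniq U) _ _ Ga.
- by move=> u; rewrite mem_iota => /andP[+ _]; apply: fresh_notin.
- move=> u uU; split=> [i w _ _|i _ w w' _ _ /p1 -> /p1 -> //|w _ i i' iR iR' /p1 -> /p1].
    by rewrite /p; case: eqP; [right|left].
  exact: tgtI.
exists (C ++ U), (fun i j z => b j i z).
have bCl i z : [seq b j i z | j <- C] = [seq a i j z | j <- C].
  by apply/eq_in_map => j jC; rewrite bC.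
have bUl i z : [seq b j i z | j <- U] = [seq p j i z | j <- U].
  by apply/eq_in_map => j jC; rewrite bU.
split=> //.
- move=> j z; rewrite mem_cat => /orP[jC|jU] zH; first by rewrite bC //; apply: Li.
  rewrite -alt0_nz bU //.
  have [i _|i i' iR iR' /p1 -> /p1|->|->] := @nz_map_atmost1 _ (fun i => p j i z) R 1 isT uR => //.
    by rewrite /p; case: eqP; [right|left].
  exact: tgtI.
- move=> i z iR zH'; rewrite -alt_nz map_cat nz_cat bCl bUl.
  have zH0 : (forall u, u \in U -> z != tgt u i) -> nz [seq p u i z | u <- U] = [::].
    by move=> zt; apply: nz_map0 => u /zt /negbTE; rewrite /p => ->.
  case: (boolP (z \in H)) => zH.
    rewrite zH0 ?cats0 ?alt_nz; first exact: Lj.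
    move=> u uU; apply: contraTneq zH => ->.
    by case/andP: (tgtH u i uU iR).
  case: (boolP (z \in W i)) => zW.
    rewrite zH0 ?cats0.
      by move: zW; rewrite WP zH' zH /=; case: (line_new i z zH' zH) => ->.
    move=> u uU; apply/eqP => E; have := tgtW u i uU iR; rewrite -E => /(Wfun _ _ _ zW) Ei.
    have E0 : nxt i 0%N = nxt i (dd u).
      by rewrite -Ei /nxt addn0 modn_small ?index_mem // nth_index.
    have [d1 _] := Ub u uU; have /eqP := nxtI _ _ _ _ iR iR E0.
    by rewrite eqn_modDl mod0n modn_small.
  have -> : nz [seq a i j z | j <- C] = [::].
    by move: zW; rewrite WP zH' zH /= negbK => /eqP.
  (* The zero line is filled exactly once: [z] lies in [W i'] for another row [i'], so the shift
     from [i] to [i'] and the place of [z] in [W i'] determine the column plane. *)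
  have [i' iR' zW'] := Wex z zH' zH; have mp := m0 i iR.
  have ii : i != i' by apply: contraNneq zW => ->.
  have li : (index i R < m)%N by rewrite index_mem.
  have li' : (index i' R < m)%N by rewrite index_mem.
  have nii : index i R != index i' R.
    by apply: contraNneq ii => /(congr1 (nth 0%N R)); rewrite !nth_index // => ->.
  pose d := if (index i R < index i' R)%N then (index i' R - index i R)%N
            else (index i' R + m - index i R)%N.
  have d0 : (0 < d < m)%N by rewrite /d; case: ifP; lia.
  have nd : nxt i d = i'.
    rewrite /nxt; have -> : ((index i R + d) %% m = index i' R)%N.
      rewrite /d; case: ifP => lt; first by rewrite subnKC ?modn_small //; lia.
      by rewrite subnKC ?modnDr ?modn_small //; lia.
    exact: nth_index.
  pose s := index z (W i'); have sc : (s < c)%N by rewrite -(cW i') // index_mem.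
  pose u := (fresh C + (d.-1 * c + s))%N.
  have du : dd u = d.
    by rewrite /dd /u addKn divnMDl ?divn_small ?addn0 //; lia.
  have su : ss u = s by rewrite /ss /u addKn modnMDl modn_small.
  have uU : u \in U.
    rewrite mem_iota /u leq_addr ltn_add2l /=.
    apply: (@leq_trans (d.-1 * c + c)%N); first by rewrite ltn_add2l.
    by rewrite addnC -mulSn leq_mul2r; apply/orP; right; lia.
  rewrite /= (@nz_map1 _ _ _ 1 u) ?iota_uniq //.
    by rewrite /p /tgt du su nd nth_index ?eqxx.
  move=> u' uU' ne; rewrite /p; case: eqP => // E; case/eqP: ne.
  have := tgtW u' i uU' iR; rewrite -E => /(Wfun _ _ _ zW') nd'.
  have [d1' s1'] := Ub u' uU'.
  have ed : dd u' = d.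
    have /eqP := @nxtI d (dd u') i i iR iR (etrans nd nd').
    by rewrite eqn_modDl !modn_small //; [move/eqP | lia].
  have es : ss u' = s.
    by rewrite /s E /tgt -nd' index_uniq ?cW.
  have := divn_eq (u' - fresh C) c; rewrite -/(ss u') es => e'.
  move: uU'; rewrite mem_iota => /andP[fu' _].
  have : ((u' - fresh C) %/ c)%N = d.-1 by rewrite -ed.
  by move=> e2; rewrite /u -e2 -e' subnKC.
- move=> i j iR; rewrite mem_cat => /orP[jC|jU]; first by rewrite bC //; apply: Lz.
  apply: nz1_alt; rewrite bU //; have /andP[tH _] := tgtH j i jU iR.
  apply: (@nz_map1 _ _ _ 1 (tgt j i)) => //; first by rewrite /p eqxx.
  by move=> w _ /negbTE; rewrite /p => ->.
Qed.

(** Summing planes both ways shows that [C] and [H] have the same size [N] and that each of their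
    labels meets exactly [N - m] zero lines of the first direction; the matchings of this regular
    graph are the planes to add. *)
Lemma complete_planes R C H a : G R C H a -> R != [::] -> H != [::] ->
  LI alt0 R C H a -> LJ (alt false) R C H a -> LZ (alt false) R C H a ->
  exists R' b, [/\ G R' C H b, size C = size R', size H = size R' &
    [/\ LI (alt false) R' C H b, LJ (alt false) R' C H b & LZ (alt false) R' C H b]].
Proof.
move=> Ga R0 H0 Li Lj Lz; have [uR uC uH] := reach_uniq Gr Ga.
pose N := size C; pose m := size R.
have sumZ i : i \in R -> \sum_(j <- C) \sum_(z <- H) a i j z = N%:Z.
  move=> iR; rewrite -sum_one; apply: eq_big_seq => j jC.
  by apply: alt_line_sum; apply: Lz.
have sizeH : size H = N.
  have [i iR] : exists i, i \in R by case: (R) R0 => // i s _; exists i; rewrite mem_head.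
  have := sumZ i iR; rewrite exchange_big /= (eq_big_seq (fun _ => 1)).
    by rewrite sum_one => -[].
  by move=> z zH; apply: alt_line_sum; apply: Lj.
pose zero j z := nz [seq a i j z | i <- R] == [::].
have lineI j z : j \in C -> z \in H -> \sum_(i <- R) a i j z = (~~ zero j z)%:R.
  by move=> jC zH; apply: alt0_line_sum; apply: Li.
(* Column plane [j] has sum [m] by its [m] alternating lines, and each nonzero first-direction line
   in it contributes 1. *)
have cntJ j : j \in C -> (count (zero j) H + m)%N = N.
  move=> jC; have : \sum_(z <- H) \sum_(i <- R) a i j z = m%:Z.
    rewrite exchange_big -sum_one; apply: eq_big_seq => i iR.
    by apply: alt_line_sum; apply: Lz.
  rewrite (eq_big_seq (fun z => (~~ zero j z)%:R)); last by move=> z; apply: lineI.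
  by rewrite sum_pred => -[<-]; rewrite -sizeH -(count_predC (zero j) H).
have cntZ z : z \in H -> (count (zero^~ z) C + m)%N = N.
  move=> zH; have : \sum_(j <- C) \sum_(i <- R) a i j z = m%:Z.
    rewrite exchange_big -sum_one; apply: eq_big_seq => i iR.
    by apply: alt_line_sum; apply: Lj.
  rewrite (eq_big_seq (fun j => (~~ zero j z)%:R)); last by move=> j jC; apply: lineI.
  by rewrite sum_pred => -[<-]; rewrite /N -(count_predC (zero^~ z) C).
(* Makes the truncated difference [N - m] a true one, so that the final number of row planes is
   [N]. *)
have leN : (m <= N)%N.
  by case: (H) H0 cntZ => // z s _ /(_ z); rewrite mem_head => /(_ isT) <-; rewrite leq_addl.
have CP (p : 'I_N) : nth 0%N C p \in C by rewrite mem_nth.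
have HP (q : 'I_N) : nth 0%N H q \in H by rewrite mem_nth ?sizeH.
have Cex j : j \in C -> exists p : 'I_N, j = nth 0%N C p.
  by move=> jC; have lt : (index j C < N)%N; [rewrite index_mem | exists (Ordinal lt); rewrite /= nth_index].
have Hex z : z \in H -> exists q : 'I_N, z = nth 0%N H q.
  by move=> zH; have lt : (index z H < N)%N; [rewrite -sizeH index_mem | exists (Ordinal lt); rewrite /= nth_index].
pose D (p q : 'I_N) := zero (nth 0%N C p) (nth 0%N H q).
pose d := (N - m)%N.
have [p|q|f [fI fD fU fE]] := @regular_decomposition _ D d.
- by have := cntJ _ (CP p); rewrite (count_nth _ sizeH) /d => /(canRL (addnK _)).
- by have := cntZ _ (HP q); rewrite (count_nth _ (erefl N)) /d => /(canRL (addnK _)).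
pose P t j z : int :=
  ([exists p : 'I_N, (nth 0%N C p == j) && (nth 0%N H (f t p) == z)])%:R.
have PE t (p q : 'I_N) : P t (nth 0%N C p) (nth 0%N H q) = (f t p == q)%:R.
  rewrite /P; congr (nat_of_bool _)%:R; apply/existsP/eqP => [[p'] /andP[]|<-].
    by rewrite !nth_uniq ?sizeH // => /eqP/val_inj -> /eqP/val_inj.
  by exists p; rewrite !eqxx.
have PE1 t (p q : 'I_N) : P t (nth 0%N C p) (nth 0%N H q) = 1 -> f t p = q.
  by rewrite PE; case: eqP.
pose X := iota (fresh R) d; pose t_ x := (x - fresh R)%N.
have Xt x : x \in X -> (t_ x < d)%N by rewrite mem_iota /t_; lia.
have P01 t j z : P t j z = 0 \/ P t j z = 1 by rewrite /P; case: [exists p, _]; [right|left].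
have [||b [Gb bR bX]] :=
  append_planes (p := fun x => P (t_ x)) (reach_insI Gr) (iota_uniq _ _ : uniq X) _ _ Ga.
- by move=> x; rewrite mem_iota => /andP[+ _]; apply: fresh_notin.
- move=> x /Xt xt; split=> [j z _ _|_ /Cex[p ->] _ _ /Hex[q ->] /Hex[q' ->]|].
  + exact: P01.
  + by move=> /PE1 <- /PE1 <-.
  + move=> _ /Hex[q ->] _ _ /Cex[p ->] /Cex[p' ->] /PE1 <- /PE1 /esym.
    by move/(fI _ xt) ->.
exists (R ++ X), b; split; rewrite ?size_cat ?size_iota ?sizeH -/N -/m /d; try lia.
  exact: Gb.
split.
- move=> _ _ /Cex[p ->] /Hex[q ->]; rewrite -alt_nz map_cat nz_cat.
  have -> : [seq b i (nth 0%N C p) (nth 0%N H q) | i <- R] =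
            [seq a i (nth 0%N C p) (nth 0%N H q) | i <- R].
    by apply/eq_in_map => i iR; rewrite bR.
  have -> : [seq b i (nth 0%N C p) (nth 0%N H q) | i <- X] =
            [seq (f (t_ x) p == q)%:R | x <- X].
    by apply/eq_in_map => x xX; rewrite bX // PE.
  (* A zero line gets its [1] from the only matching that contains its edge; a nonzero line is no
     edge and gets zeros. *)
  case: (boolP (D p q)) => Dpq.
    rewrite (eqP Dpq) /=; have [t td tE] := fE p q Dpq.
    rewrite (@nz_map1 _ _ _ 1 (fresh R + t)%N) ?iota_uniq //.
    + by rewrite mem_iota leq_addr ltn_add2l.
    + by rewrite /t_ addKn tE eqxx.
    move=> x xX xt; case: eqP => // E; case/eqP: xt.
    rewrite (fU t (t_ x) p td (Xt x xX)) ?E // /t_ subnKC //.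
    by move: xX; rewrite mem_iota => /andP[].
  rewrite [X in _ ++ X]nz_map0.
    rewrite cats0 alt_nz; have := Li _ _ (CP p) (HP q).
    by rewrite /alt0; move: Dpq; rewrite /D /zero => /negbTE ->.
  move=> x xX; case: eqP => // E; case/negP: Dpq; rewrite -E; exact/fD/Xt.
- move=> i z; rewrite mem_cat => /orP[iR|iX] /Hex[q ->]; first by rewrite bR //; apply: Lj.
  have [g fK gK] := injF_bij (fI _ (Xt i iX)).
  apply: nz1_alt; rewrite bX //; apply: (@nz_map1 _ _ _ 1 (nth 0%N C (g q))) => //.
    by rewrite PE gK eqxx.
  move=> _ /Cex[p ->] ne; rewrite PE; case: eqP => // E; case/eqP: ne.
  by rewrite -E fK.
- move=> i j; rewrite mem_cat => /orP[iR|iX] /Cex[p ->]; first by rewrite bR //; apply: Lz.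
  apply: nz1_alt; rewrite bX //; apply: (@nz_map1 _ _ _ 1 (nth 0%N H (f (t_ i) p))) => //.
    by rewrite PE eqxx.
  move=> _ /Hex[q ->] ne; rewrite PE; case: eqP => // E; case/eqP: ne.
  by rewrite -E.
Qed.

End Completion.

(** * From labels to ordinals *)

Definition represents m n k (A : hyp m n k) (R C H : seq nat) (a : lhyp) : Prop :=
  [/\ size R = m, size C = n, size H = k &
      forall i j l, A i j l = a (nth 0%N R i) (nth 0%N C j) (nth 0%N H l)].

(* Quantifying over all sizes avoids casts between ['I_(size (s1 ++ x :: s2))]
   and ['I_(size (s1 ++ s2)).+1]. *)
Definition lreach m0 n0 k0 (A0 : hyp m0 n0 k0) : lpred := fun R C H a =>
  [/\ uniq R, uniq C, uniq H &
      forall m n k (A : hyp m n k), represents A R C H a -> reach A0 A].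

(** [bump] is the value of [lift], so deleting the inserted plane corresponds to deleting its
    label. *)
Lemma nth_insert_bump (s1 s2 : seq nat) x i :
  nth 0%N (s1 ++ x :: s2) (bump (size s1) i) = nth 0%N (s1 ++ s2) i.
Proof.
rewrite !nth_cat /bump; case: (leqP (size s1) i) => /= h.
  by rewrite add1n ltnNge leqW //= subSn.
by rewrite add0n h.
Qed.

Lemma uniq_insert (s1 s2 : seq nat) x :
  uniq (s1 ++ x :: s2) = (x \notin s1 ++ s2) && uniq (s1 ++ s2).
Proof. by rewrite -[x :: s2]cat1s uniq_catCA. Qed.

Lemma set_plane_other a x p i : i != x -> set_plane a x p i = a i.
Proof. by rewrite /set_plane => /negbTE ->. Qed.

Lemma lsub_pm_subperm v (C H : seq nat) p m n (P : 'I_m -> 'I_n -> int) :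
  v = 1 \/ v = -1 -> uniq C -> uniq H -> size C = m -> size H = n -> lsub v C H p ->
  (forall i j, P i j = p (nth 0%N C i) (nth 0%N H j)) -> pm_subperm_mx P.
Proof.
move=> v1 uC uH sC sH [p01 pH pC] PE.
have Ci (i : 'I_m) : nth 0%N C i \in C by rewrite mem_nth ?sC.
have Hi (i : 'I_n) : nth 0%N H i \in H by rewrite mem_nth ?sH.
have Pv i j : P i j = 0 \/ P i j = v by rewrite PE; apply: p01.
have PH i j j' : P i j = v -> P i j' = v -> j = j'.
  rewrite !PE => e e'; have /eqP := pH _ (Ci i) _ _ (Hi j) (Hi j') e e'.
  by rewrite nth_uniq ?sH // => /eqP/val_inj.
have PC i i' j : P i j = v -> P i' j = v -> i = i'.
  rewrite !PE => e e'; have /eqP := pC _ (Hi j) _ _ (Ci i) (Ci i') e e'.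
  by rewrite nth_uniq ?sC // => /eqP/val_inj.
case: v1 => E; rewrite E in Pv PH PC; [left|right]; first by split.
have N1 i j : - P i j = 1 -> P i j = -1 by move=> e; rewrite -[LHS]opprK e.
split; first by move=> i j; case: (Pv i j) => ->; [left|right].
by split=> [i j j' /N1 e /N1|i i' j /N1 e /N1]; [apply: PH|apply: PC].
Qed.

Section Insert.
Variables (m0 n0 k0 : nat) (A0 : hyp m0 n0 k0).

Lemma nth_neq (s : seq nat) x i : x \notin s -> (i < size s)%N -> nth 0%N s i != x.
Proof. by move=> xs lt; apply: contraNneq xs => <-; apply: mem_nth. Qed.

Lemma lreach_insI : ins_closed (lreach A0).
Proof.
move=> R1 R2 C H a x p v v1 xR ps [uR uC uH GA].
split; rewrite ?uniq_insert ?xR // => m n k B [sR sC sH BE].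
move: sR; rewrite size_cat /= addnS -size_cat; case: m B BE => // m B BE [sR].
have tm : (size R1 < m.+1)%N by rewrite -sR size_cat ltnS leq_addr.
pose t := Ordinal tm.
apply: (@reach_r _ _ _ _ _ _ _ (fun i j l => B (lift t i) j l)).
  apply: GA; split=> // i j l; rewrite BE /= nth_insert_bump set_plane_other //.
  by apply: nth_neq => //; rewrite sR.
exists t; split=> //; apply: (lsub_pm_subperm v1 uC uH sC sH ps) => j l.
by rewrite BE /= nth_cat ltnn subnn /set_plane /= eqxx.
Qed.

Lemma lreach_insJ : ins_closed (colG (lreach A0)).
Proof.
move=> C1 C2 R H a x p v v1 xC ps [uR uC uH GA].
split; rewrite ?uniq_insert ?xC // => m n k B [sR sC sH BE].
move: sC; rewrite size_cat /= addnS -size_cat; case: n B BE => // n B BE [sC].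
have tm : (size C1 < n.+1)%N by rewrite -sC size_cat ltnS leq_addr.
pose t := Ordinal tm.
apply: (@reach_c _ _ _ _ _ _ _ (fun i j l => B i (lift t j) l)).
  apply: GA; split=> // i j l; rewrite BE /= nth_insert_bump set_plane_other //.
  by apply: nth_neq => //; rewrite sC.
exists t; split=> //; apply: (lsub_pm_subperm v1 uR uH sR sH ps) => i l.
by rewrite BE /= nth_cat ltnn subnn /set_plane /= eqxx.
Qed.

Lemma lreach_insZ : ins_closed (horG (lreach A0)).
Proof.
move=> H1 H2 R C a x p v v1 xH ps [uR uC uH GA].
split; rewrite ?uniq_insert ?xH // => m n k B [sR sC sH BE].
move: sH; rewrite size_cat /= addnS -size_cat; case: k B BE => // k B BE [sH].
have tm : (size H1 < k.+1)%N by rewrite -sH size_cat ltnS leq_addr.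
pose t := Ordinal tm.
apply: (@reach_h _ _ _ _ _ _ _ (fun i j l => B i j (lift t l))).
  apply: GA; split=> // i j l; rewrite BE /= nth_insert_bump set_plane_other //.
  by apply: nth_neq => //; rewrite sH.
exists t; split=> //; apply: (lsub_pm_subperm v1 uR uC sR sC ps) => i j.
by rewrite BE /= nth_cat ltnn subnn /set_plane /= eqxx.
Qed.

Lemma lreach_reachable : reachable (lreach A0).
Proof.
split; [exact: lreach_insI|exact: lreach_insJ|exact: lreach_insZ|].
by move=> R C H a [].
Qed.

(** Labels out of range get 0, which keeps all values in the allowed set. *)
Definition label_fun : lhyp := fun i j l =>
  if (insub i, insub j, insub l) is (Some p, Some q, Some r) then A0 p q r else 0.

Lemma lreach_start : lreach A0 (iota 0 m0) (iota 0 n0) (iota 0 k0) label_fun.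
Proof.
split; rewrite ?iota_uniq // => m n k A; rewrite /represents !size_iota => -[em en ek].
subst m n k => AE.
(* [reach_refl] concerns [A0] itself, so pointwise equality has to become equality of functions. *)
suff -> : A = A0 by apply: reach_refl.
apply: functional_extensionality => i; apply: functional_extensionality => j.
apply: functional_extensionality => l.
by rewrite AE !nth_iota // !add0n /label_fun !valK.
Qed.

Lemma label_fun_sgn : (forall p q r, A0 p q r \in [:: 0; 1; -1]) ->
  forall i j l, label_fun i j l \in [:: 0; 1; -1].
Proof.
move=> A0s i j l; rewrite /label_fun.
by case: (insub i) => [p|] //; case: (insub j) => [q|] //; case: (insub l).
Qed.

End Insert.

(** The embeddings are composed of the maps [lift t] of the successive insertions, each strictly
    increasing and skipping the new plane. *)
Lemma reach_embedding m0 n0 k0 (A0 : hyp m0 n0 k0) m n k (A : hyp m n k) : reach A0 A ->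
  exists (I : 'I_m0 -> 'I_m) (J : 'I_n0 -> 'I_n) (K : 'I_k0 -> 'I_k),
    [/\ [/\ m0 <= m, n0 <= n & k0 <= k]%N, strict_incr I, strict_incr J, strict_incr K &
        forall p q r, A0 p q r = A (I p) (J q) (K r)].
Proof.
have incr_lift a b (t : 'I_b.+1) (f : 'I_a -> 'I_b) :
    strict_incr f -> strict_incr (fun i => lift t (f i)).
  move=> fi p q /fi; rewrite /= /bump; case: leqP; case: leqP => /=; lia.
elim=> [|{}m {}n {}k {}A B _ [I [J [K [[? ? ?] II JI KI E]]]] [t [tE _]]
  |{}m {}n {}k {}A B _ [I [J [K [[? ? ?] II JI KI E]]]] [t [tE _]]
  |{}m {}n {}k {}A B _ [I [J [K [[? ? ?] II JI KI E]]]] [t [tE _]]].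
- by exists id, id, id; split=> //; split.
- exists I, J, (fun l => lift t (K l)); split=> //; [|exact: incr_lift|].
    by split=> //; apply: leqW.
  by move=> p q r; rewrite tE E.
- exists (fun l => lift t (I l)), J, K; split=> //; [|exact: incr_lift|].
    by split=> //; apply: leqW.
  by move=> p q r; rewrite tE E.
- exists I, (fun l => lift t (J l)), K; split=> //; [|exact: incr_lift|].
    by split=> //; apply: leqW.
  by move=> p q r; rewrite tE E.
Qed.

Lemma map_nth_enum (T : Type) (f : nat -> T) (s : seq nat) N : size s = N ->
  [seq f (nth 0%N s i) | i : 'I_N <- enum 'I_N] = map f s.
Proof.
move=> <-; rewrite -[in RHS](mkseq_nth 0%N s) /mkseq -val_enum_ord -!map_comp.
exact: eq_map.
Qed.

Lemma zero_plane_lsub C H : lsub 1 C H (fun _ _ => 0).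
Proof. by split=> //; left. Qed.

(** The zero matrix is a subpermutation matrix, so a direction without planes can be made
    nonempty. *)
Lemma insert_zero_plane (G : lpred) R C H a : ins_closed G -> G R C H a ->
  exists R' b, [/\ G R' C H b, R' != [::] &
    forall i j z, b i j z = a i j z \/ b i j z = 0].
Proof.
move=> Gins Ga; exists (fresh R :: R), (set_plane a (fresh R) (fun _ _ => 0)); split=> //.
  apply: (Gins [::] R _ _ _ _ _ 1) => //; [by left|exact: fresh_notin|exact: zero_plane_lsub].
by move=> i j z; rewrite /set_plane; case: eqP; [right|left].
Qed.

Theorem mainTheorem20 (m' n' k' : nat) (A' : hyp m' n' k')
  (hA' : forall p q r, A' p q r \in [:: 0; 1; -1]) :
  exists (n : nat) (A : hyp n n n) (I : 'I_m' -> 'I_n) (J : 'I_n' -> 'I_n)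
         (K : 'I_k' -> 'I_n),
    (maxn m' (maxn n' k') <= n)%N /\
    is_ASHM A /\
    strict_incr I /\ strict_incr J /\ strict_incr K /\
    (forall p q r, A' p q r = A (I p) (J q) (K r)) /\
    reach A' A.
Proof.
have Gr := lreach_reachable A'.
(* The counting in [complete_planes] takes a row and a horizontal plane, while [m'] and [k'] may be
   0. *)
have [R1 [a1 [G1 R1n E1]]] := insert_zero_plane (reach_insI Gr) (lreach_start A').
have [H1 [a2 [G2 H1n E2]]] := insert_zero_plane (G := horG (lreach A'))
  (a := fun z i j => a1 i j z) (reach_insZ Gr) G1.
have ent i j z : a2 z i j \in [:: 0; 1; -1].
  by case: (E2 z i j) => -> //; case: (E1 i j z) => -> //; apply: label_fun_sgn.
have [|R [C [H [H' [a [G3 Rn Hn [sH new Li Lj Lz]]]]]]] :=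
  alt_all_but_new_horizontal Gr G2 R1n H1n; first by move=> i j z _ _ _; apply: ent.
have [C' [b [G4 Li4 Lj4 Lz4]]] := balance_planes Gr G3 sH new Li Lj Lz.
have Hn' : H' != [::] by case: (H) Hn sH => // h ? _ /(_ h (mem_head _ _)); case: (H').
have [R' [c [[uR uC uH GA] sC sH' [Li5 Lj5 Lz5]]]] := complete_planes Gr G4 Rn Hn' Li4 Lj4 Lz4.
pose N := size R'.
pose A : hyp N N N := fun i j l => c (nth 0%N R' i) (nth 0%N C' j) (nth 0%N H' l).
have rA : reach A' A by apply: GA.
have [I [J [K [[m1 m2 m3] II JI KI E]]]] := reach_embedding rA.
have RP (i : 'I_N) : nth 0%N R' i \in R' by rewrite mem_nth.
have CP (i : 'I_N) : nth 0%N C' i \in C' by rewrite mem_nth ?sC.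
have HP (i : 'I_N) : nth 0%N H' i \in H' by rewrite mem_nth ?sH'.
exists N, A, I, J, K; split; first by rewrite !geq_max m1 m2 m3.
do !split=> //.
- move=> i j l; have /allP := alt_entries (Li5 _ _ (CP j) (HP l)); apply.
  by apply/mapP; exists (nth 0%N R' i).
- move=> j l; apply: alt_alt_line; rewrite /A.
  rewrite (map_nth_enum (fun i => c i _ _) (erefl N)); exact: Li5.
- move=> i l; apply: alt_alt_line; rewrite /A.
  rewrite (map_nth_enum (fun j => c _ j _) sC); exact: Lj5.
- move=> i j; apply: alt_alt_line; rewrite /A.
  rewrite (map_nth_enum (fun l => c _ _ l) sH'); exact: Lz5.
Qed.
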